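(* Suppose that the initial state satisfies $x(k_0)=x(0)\in\mathcal{S}$ and that the self-triggered strategy Algorithm 2 described in the context is implemented on the system $x(k+1)=Ax(k)+Bu(k)$. Then the resulting closed-loop state satisfies $x(k)\to 0$ as $k\to\infty$.
   Context: Notation: $\mathbb{N}=\{0,1,2,\dots\}$. A set in $\mathbb{R}^n$ is a $\mathcal{C}$-set if it is compact, convex and contains $0$ in its interior. For $\mu\in\mathbb{R}$, $\mu\mathcal{S}=\{\mu x: x\in\mathcal{S}\}$. The gauge function of $\mathcal{S}$ is $\Psi_{\mathcal{S}}(x)=\inf\{\mu\ge 0: x\in\mu\mathcal{S}\}$. System: $x(k+1)=Ax(k)+Bu(k)$, $k\in\mathbb{N}$, with $x(k)\in\mathbb{R}^n$, $u(k)\in\mathbb{R}^m$. Standing assumptions: $(A,B)$ is controllable and $B$ has full column rank. The constraints are $x(k)\in\mathcal{X}$, $u(k)\in\mathcal{U}$ for all $k\in\mathbb{N}$, where $\mathcal{X}=\{x\in\mathbb{R}^n: H_xx\le h_x\}$ and $\mathcal{U}=\{u\in\mathbb{R}^m: H_uu\le h_u\}$ are polyhedral $\mathcal{C}$-sets, with $h_x,h_u$ having positive components. Contractive set: a $\mathcal{C}$-set $\mathcal{S}\subseteq\mathcal{X}$ is $\lambda$-contractive in $\mathcal{X}$ (for $\lambda\in[0,1]$) if there is a control law $g$ with $g(x)\in\mathcal{U}$ such that $Ax+Bg(x)\in\lambda\mathcal{S}$ for all $x\in\mathcal{S}$. Fix $\lambda\in[0,1)$ and a $\lambda$-contractive set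 $\mathcal{S}=\mathrm{co}\{v_1,\dots,v_N\}\subseteq\mathcal{X}$ that is a polytope with vertices $v_1,\dots,v_N$. Fix an integer $j_{\max}\ge 1$ and weights $w_1,w_2\ge 0$. Decomposition: fix an integer $L\ge 1$ and scalars $0<\rho_1<\rho_2<\dots<\rho_L=1$. Set $\mathcal{S}_1=\rho_1\mathcal{S}$ and $\mathcal{S}_\ell=\rho_\ell\mathcal{S}\setminus\rho_{\ell-1}\mathcal{S}$ for $\ell\in\{2,\dots,L\}$; these sets are disjoint with union $\mathcal{S}$. Set $v_{\ell,n}=\rho_\ell v_n$. Problem 2 for $(\ell,j)\in\{1,\dots,L\}\times\{1,\dots,j_{\max}\}$: minimize $\varepsilon$ over $u_1,\dots,u_N\in\mathcal{U}$ and $\varepsilon\in[0,\lambda]$ subject to (C.1) $A^{j'}v_{\ell,n}+\sum_{i=1}^{j'}A^{i-1}Bu_n\in\mathcal{X}$ for all $n\in\{1,\dots,N\}$, $j'\in\{1,\dots,j\}$; (C.2) $A^{j}v_{\ell,n}+\sum_{i=1}^{j}A^{i-1}Bu_n\in\varepsilon\rho_\ell\mathcal{S}$ for all $n\in\{1,\dots,N\}$. When it is feasible, $u^*_{\ell,j}(1),\dots,u^*_{\ell,j}(N)\in\mathcal{U}$ and $\varepsilon^*_{\ell,j}\in[0,\lambda]$ denote an optimal solution. Let $\mathcal{J}_\ell$ be the set of $j\in\{1,\dots,j_{\max}\}$ for which Problem 2 is feasible for $(\ell,j)$. For each $\ell$ choose (offline) $j_\ell^*\in\operatorname{argmax}_{j\in\mathcal{J}_\ell}\{w_1(1-\varepsilon^*_{\ell,j})/j+w_2j\}$.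 The transmission mapping is $\Gamma(x)=j_\ell^*$ if $x\in\mathcal{S}_\ell$. Algorithm 2: set $k_0=0$. At each transmission time $k_m$, $m\in\mathbb{N}$: (1) the plant transmits $x(k_m)$ to the controller; (2) the controller sets $j_m=\Gamma(x(k_m))$ and $k_{m+1}=k_m+j_m$; (3) with $\ell_m$ such that $x(k_m)\in\mathcal{S}_{\ell_m}$ and $\varepsilon_x=\Psi_{\mathcal{S}}(x(k_m))$, the controller sets $u^*(k_m)=(\varepsilon_x/\rho_{\ell_m})\sum_{n=1}^N\lambda_n u^*_{\ell_m,j_m}(n)$, where $\lambda_1,\dots,\lambda_N\in[0,1]$ satisfy $\sum_{n=1}^N\lambda_n=1$ and $x(k_m)=\varepsilon_x\sum_{n=1}^N\lambda_n v_n$, and transmits $u^*(k_m)$ and $k_{m+1}$ to the plant; (4) the plant applies $u(k)=u^*(k_m)$ for all $k\in[k_m,k_{m+1})$; then $m\leftarrow m+1$ and the procedure repeats. *)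

(* Defs.v *)
From mathcomp Require Import all_boot all_order all_algebra.
From mathcomp Require Import all_classical all_reals all_analysis.

Set Implicit Arguments.
Unset Strict Implicit.
Unset Printing Implicit Defensive.

Import Order.TTheory GRing.Theory Num.Theory.
Import numFieldNormedType.Exports.

Local Open Scope classical_set_scope.
Local Open Scope ring_scope.

Section Sets.
Context {R : realType} {n : nat}.
Implicit Types (S : set 'cV[R]_n) (x : 'cV[R]_n) (mu : R).

Definition C_set S : Prop :=
  [/\ compact S, convex_set (S : set (convex_lmodType 'cV[R]_n))
    & interior S (0 : 'cV[R]_n)].

Definition scale_set mu S : set 'cV[R]_n := [set mu *: x | x in S].

(* The infimum is taken in R, so it is meaningful when x lies in some mu S;
   this is the case for every x when S is a C-set. *)
Definition gauge_fun S x : R := inf [set mu | 0 <= mu /\ scale_set mu S x].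

Definition polyhedron {p : nat} (H : 'M[R]_(p, n)) (h : 'cV[R]_p)
    : set 'cV[R]_n :=
  [set x | forall i, (H *m x) i 0 <= h i 0].

Definition convex_weights {N : nat} (a : 'I_N -> R) : Prop :=
  (forall i, 0 <= a i <= 1) /\ \sum_i a i = 1.

Definition convex_hull {N : nat} (v : 'I_N -> 'cV[R]_n) : set 'cV[R]_n :=
  [set x | exists2 a : 'I_N -> R, convex_weights a & x = \sum_i a i *: v i].

Definition extreme_point S x : Prop :=
  S x /\ forall (y z : 'cV[R]_n) (t : R), S y -> S z -> 0 < t < 1 ->
    x = t *: y + (1 - t) *: z -> y = x /\ z = x.

Definition polytope_with_vertices {N : nat} S (v : 'I_N -> 'cV[R]_n) : Prop :=
  [/\ S = convex_hull v, injective v & forall i, extreme_point S (v i)].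

(* rho is used at the indices 1, ..., L only *)
Definition scaling_factors (L : nat) (rho : nat -> R) : Prop :=
  [/\ 0 < rho 1%N,
      forall l, (1 <= l < L)%N -> rho l < rho l.+1
    & rho L = 1].

Definition layer S (rho : nat -> R) (l : nat) : set 'cV[R]_n :=
  if l == 1%N then scale_set (rho 1%N) S
  else scale_set (rho l) S `\` scale_set (rho l.-1) S.

End Sets.

Section System.
Context {R : realType} {n m : nat}.
Variables (A : 'M[R]_n) (B : 'M[R]_(n, m)).

Definition trajectory (x : nat -> 'cV[R]_n) (u : nat -> 'cV[R]_m) : Prop :=
  forall k, x k.+1 = A *m x k + B *m u k.

Definition controllable : Prop :=
  forall x0 xf : 'cV[R]_n,
    exists (T : nat) (x : nat -> 'cV[R]_n) (u : nat -> 'cV[R]_m),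
      [/\ trajectory x u, x 0%N = x0 & x T = xf].

Definition contractive (lam : R) (X : set 'cV[R]_n) (U : set 'cV[R]_m)
    (S : set 'cV[R]_n) : Prop :=
  [/\ C_set S, S `<=` X
    & exists g : 'cV[R]_n -> 'cV[R]_m, forall x, S x ->
        U (g x) /\ scale_set lam S (A *m x + B *m g x)].

(* State reached from x after j steps under the constant input u *)
Definition hold_state (j : nat) (x : 'cV[R]_n) (u : 'cV[R]_m) : 'cV[R]_n :=
  A ^+ j *m x + \sum_(1 <= i < j.+1) A ^+ i.-1 *m B *m u.

Section Problem.
Variables (X : set 'cV[R]_n) (U : set 'cV[R]_m) (S : set 'cV[R]_n).
Variables (N : nat) (v : 'I_N -> 'cV[R]_n) (rho : nat -> R) (lam : R).

Definition feasible (l j : nat) (u : 'I_N -> 'cV[R]_m) (eps : R) : Prop :=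
  [/\ forall i, U (u i),
      0 <= eps <= lam,
      forall i j', (1 <= j' <= j)%N -> X (hold_state j' (rho l *: v i) (u i))
    & forall i, scale_set (eps * rho l) S (hold_state j (rho l *: v i) (u i))].

Definition is_feasible (l j : nat) : Prop := exists u eps, feasible l j u eps.

Definition optimal (l j : nat) (u : 'I_N -> 'cV[R]_m) (eps : R) : Prop :=
  feasible l j u eps /\
  forall u' eps', feasible l j u' eps' -> eps <= eps'.

Definition feasible_horizons (jmax l : nat) : set nat :=
  [set j | (1 <= j <= jmax)%N /\ is_feasible l j].

End Problem.

(* The control update is required at k_m only when the measured state lies in
   one of the layers; that this always happens is not built into the
   definition. *)
Definition closed_loop (S : set 'cV[R]_n) (N : nat) (v : 'I_N -> 'cV[R]_n)
    (L : nat) (rho : nat -> R) (uopt : nat -> nat -> 'I_N -> 'cV[R]_m)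
    (Gamma : 'cV[R]_n -> nat)
    (x : nat -> 'cV[R]_n) (u : nat -> 'cV[R]_m) : Prop :=
  trajectory x u /\
  exists (k : nat -> nat) (ustar : nat -> 'cV[R]_m),
    [/\ k 0%N = 0%N,
        forall q, k q.+1 = (k q + Gamma (x (k q)))%N,
        forall q l, (1 <= l <= L)%N -> layer S rho l (x (k q)) ->
          let epsx := gauge_fun S (x (k q)) in
          exists a : 'I_N -> R,
            [/\ convex_weights a,
                x (k q) = epsx *: \sum_i a i *: v i
              & ustar q = (epsx / rho l) *:
                  \sum_i a i *: uopt l (Gamma (x (k q))) i]
      & forall q t, (k q <= t < k q.+1)%N -> u t = ustar q].

End System.

Definition horizon_score {R : realType} (w1 w2 eps : R) (j : nat) : R :=
  w1 * (1 - eps) / j%:R + w2 * j%:R.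

Definition is_argmax {R : realType} (J : set nat) (f : nat -> R) (j : nat)
    : Prop :=
  J j /\ forall i, J i -> f i <= f j.

(* Main.v *)
Require Import Defs.
From mathcomp Require Import all_boot all_order all_algebra.
From mathcomp Require Import all_classical all_reals all_analysis.
Import Order.TTheory GRing.Theory Num.Theory.
Import numFieldNormedType.Exports.
Local Open Scope classical_set_scope.
Local Open Scope ring_scope.

(** Write [e] for the gauge of [x (k q)] and [l] for the index of its layer.
    The state is [e / rho l] times a convex combination of the scaled vertices
    [rho l *: v i], and [ustar q] is the same combination of the optimal inputs.
    By linearity, constraint (C.2) puts the next sampled state in
    [(lam * e) S], so the gauge decays geometrically along the samples. Between
    samples, constraint (C.1) keeps the trajectories issued from the scaled
    vertices in the bounded set of admissible states, so the norm of the state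
    is at most a constant times [e]. *)

(** * Convex hulls, gauge and layers *)

Section Hulls.
Context {R : realType} {n : nat}.
Implicit Types (S : set 'cV[R]_n) (x : 'cV[R]_n) (mu : R).

(** Exchanging the two sums, the weight of [v j] is the average, with weights [a], of the weights
    [b i j] of the points [y i]. *)
Lemma convex_hull_comb {N K : nat} (v : 'I_N -> 'cV[R]_n)
    (a : 'I_K -> R) (y : 'I_K -> 'cV[R]_n) :
  convex_weights a -> (forall i, convex_hull v (y i)) ->
  convex_hull v (\sum_i a i *: y i).
Proof.
move=> [a01 a1] /(_ _)/cid2-/all_sig2[b bP yE].
exists (fun j => \sum_i a i * b i j); last first.
  under [LHS]eq_bigr do rewrite yE scaler_sumr.
  rewrite exchange_big/=; apply: eq_bigr => j _.
  by rewrite scaler_suml; apply: eq_bigr => i _; rewrite scalerA.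
split=> [j|]; last first.
  rewrite exchange_big/= -a1; apply: eq_bigr => i _.
  by rewrite -mulr_sumr (bP i).2 mulr1.
have a0 i : 0 <= a i by have /andP[] := a01 i.
apply/andP; split.
  by apply: sumr_ge0 => i _; rewrite mulr_ge0//; have /andP[] := (bP i).1 j.
rewrite -a1; apply: ler_sum => i _.
by rewrite ler_piMr//; have /andP[] := (bP i).1 j.
Qed.

Lemma convex_hull_scale {N : nat} (v : 'I_N -> 'cV[R]_n) mu x :
  convex_hull v 0 -> 0 <= mu <= 1 -> convex_hull v x ->
  convex_hull v (mu *: x).
Proof.
move=> v0 /andP[mu0 mu1] vx.
(* [mu *: x] is the convex combination of [x] and [0] with weights [mu] and [1 - mu]. *)
pose a (i : 'I_2) := if i == 0 then mu else 1 - mu.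
pose y (i : 'I_2) := if i == 0 then x else 0.
suff : convex_hull v (\sum_i a i *: y i).
  by rewrite !big_ord_recl big_ord0/= /a /y/= scaler0 !addr0.
apply: convex_hull_comb => [|i]; last by rewrite /y; case: ifP.
split=> [i|].
  by rewrite /a; case: ifP => _; rewrite ?mu0 ?mu1// subr_ge0 lerBlDr lerDl mu0 mu1.
by rewrite !big_ord_recl big_ord0 /a/= addr0 addrC subrK.
Qed.

Lemma norm_convex_comb {K : nat} (a : 'I_K -> R) (y : 'I_K -> 'cV[R]_n) M :
  convex_weights a -> (forall i, `|y i| <= M) -> `|\sum_i a i *: y i| <= M.
Proof.
move=> [a01 a1] yM; apply: le_trans (ler_norm_sum _ _ _) _.
rewrite -[M]mul1r -a1 mulr_suml; apply: ler_sum => i _.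
by have /andP[a0 _] := a01 i; rewrite normrZ ger0_norm// ler_wpM2l.
Qed.

Lemma gauge_fun_le S mu x :
  0 <= mu -> scale_set mu S x -> gauge_fun S x <= mu.
Proof. by move=> mu0 Sx; apply: ge_inf => //; exists 0 => y []. Qed.

Lemma gauge_fun_ge0 S x : 0 <= gauge_fun S x.
Proof.
rewrite /gauge_fun; set E := [set _ | _].
(* [inf] takes the default value [0] on the empty set. *)
have [->|E0] := eqVneq E set0; first by rewrite inf0.
by apply: lb_le_inf; [exact/set0P|move=> y []].
Qed.

Lemma gauge_fun_le1 S x : S x -> gauge_fun S x <= 1.
Proof. by move=> Sx; apply: gauge_fun_le => //; exists x; rewrite ?scale1r. Qed.

Lemma scaling_factors_bounds (L : nat) (rho : nat -> R) (l : nat) :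
  scaling_factors L rho -> (1 <= l <= L)%N -> rho 1%N <= rho l <= 1.
Proof.
move=> [_ rhoS rhoL].
have mono d i : (1 <= i)%N -> (i + d <= L)%N -> rho i <= rho (i + d)%N.
  elim: d => [|d IH] i1 idL; first by rewrite addn0.
  rewrite addnS in idL *; apply: le_trans (IH i1 (ltnW idL)) _.
  by apply/ltW/rhoS; rewrite idL andbT ltn_addr.
move=> /andP[l1 lL]; apply/andP; split.
  by have := mono l.-1 1%N; rewrite add1n prednK//; exact.
by rewrite -rhoL -(subnKC lL); apply: mono; rewrite ?subnKC.
Qed.

(** The layer is given by the least [l >= 1] with [x] in [rho l] times [S]. The index [L] qualifies
    because [rho L = 1], and minimality excludes the previous scaled copy. *)
Lemma layer_cover S (L : nat) (rho : nat -> R) x :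
  (1 <= L)%N -> scaling_factors L rho -> S x ->
  exists2 l, (1 <= l <= L)%N & layer S rho l x.
Proof.
move=> L1 [_ _ rhoL] Sx.
pose P l := (1 <= l)%N && `[< scale_set (rho l) S x >].
have PL : P L.
  by rewrite /P L1; apply/asboolP; exists x; rewrite ?rhoL ?scale1r.
have [l /andP[l1 /asboolP Sl] lmin] := ex_minnP (ex_intro P L PL).
exists l; first by rewrite l1 lmin.
rewrite /layer; case: eqP => [<-//|/eqP lN1]; split=> // Sl'.
have l2 : (1 < l)%N by rewrite ltn_neqAle eq_sym lN1.
have l'1 : (1 <= l.-1)%N by rewrite -ltnS prednK.
have := lmin l.-1; rewrite /P l'1 (asboolT Sl') => /(_ isT).
by rewrite -ltnS prednK// ltnn.
Qed.

End Hulls.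

(** * Evolution under a constant input *)

Section Hold.
Context {R : realType} {n m : nat}.
Variables (A : 'M[R]_n) (B : 'M[R]_(n, m)).

Lemma hold_state0 x u : hold_state A B 0 x u = x.
Proof. by rewrite /hold_state big_geq// addr0 expr0 mul1mx. Qed.

Lemma hold_stateS j x u :
  hold_state A B j.+1 x u = A *m hold_state A B j x u + B *m u.
Proof.
have expS i : A *m A ^+ i = A ^+ i.+1 by rewrite exprS.
rewrite /hold_state mulmxDr mulmxA expS -addrA; congr (_ + _).
(* The term of index [1] is the input [B *m u] applied last; the other terms are the old ones
   multiplied by [A]. *)
rewrite big_nat_recl// expr0 mul1mx addrC; congr (_ + _).
rewrite mulmx_sumr; apply: eq_big_nat => i /andP[i1 _].
by rewrite !mulmxA expS prednK.
Qed.

(** The held state is linear in the pair (initial state, input), so the same coefficients must be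
    used for both. *)
Lemma hold_state_comb {K : nat} j (a : 'I_K -> R) c
    (y : 'I_K -> 'cV[R]_n) (w : 'I_K -> 'cV[R]_m) :
  hold_state A B j (c *: \sum_i a i *: y i) (c *: \sum_i a i *: w i) =
  c *: \sum_i a i *: hold_state A B j (y i) (w i).
Proof.
elim: j => [|j IH].
  by rewrite hold_state0; under [in RHS]eq_bigr do rewrite hold_state0.
rewrite hold_stateS IH -!scalemxAr -scalerDr !mulmx_sumr -big_split/=.
congr (_ *: _); apply: eq_bigr => i _.
by rewrite -!scalemxAr -scalerDr hold_stateS.
Qed.

Lemma trajectory_hold (x : nat -> 'cV[R]_n) (u : nat -> 'cV[R]_m) k j w :
  trajectory A B x u -> (forall t, (k <= t < k + j)%N -> u t = w) ->
  x (k + j)%N = hold_state A B j (x k) w.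
Proof.
move=> xP; elim: j => [|j IH] uw; first by rewrite addn0 hold_state0.
rewrite addnS xP hold_stateS -IH => [|t /andP[kt tj]].
  by rewrite uw// leq_addr addnS/=.
by apply: uw; rewrite kt addnS ltnW.
Qed.

End Hold.

(** Take the largest [q] with [k q <= t]: it exists because strict increase gives [q <= k q], and
    [Q] itself is a candidate. *)
Lemma nat_interval_cover (k : nat -> nat) Q t :
  (forall q, (k q < k q.+1)%N) -> (k Q <= t)%N ->
  exists2 q, (Q <= q)%N & (k q <= t < k q.+1)%N.
Proof.
move=> kS kQ.
have kge q : (q <= k q)%N by elim: q => // q /leq_ltn_trans; exact.
have kub q : (k q <= t)%N -> (q <= t)%N by exact: leq_trans.
have [q kq qmax] := ex_maxnP (ex_intro (fun q => k q <= t)%N Q kQ) kub.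
exists q; first exact: qmax.
by rewrite kq ltnNge; apply: contraT => /negPn/qmax; rewrite ltnn.
Qed.

(** * Consequences of (C.1) and (C.2) over one sampling period *)

Section Period.
Context {R : realType} {n m : nat}.
Variables (A : 'M[R]_n) (B : 'M[R]_(n, m)).
Variables (X : set 'cV[R]_n) (U : set 'cV[R]_m) (N : nat).
Variables (v : 'I_N -> 'cV[R]_n) (rho : nat -> R) (lam : R) (l j : nat).
Variables (w : 'I_N -> 'cV[R]_m) (eps : R) (a : 'I_N -> R) (e : R).
Hypothesis feas : feasible A B X U (convex_hull v) v rho lam l j w eps.
Hypothesis weights : convex_weights a.
Hypothesis rho_gt0 : 0 < rho l.
Hypothesis e_ge0 : 0 <= e.

Let x := e *: \sum_i a i *: v i.
Let u := (e / rho l) *: \sum_i a i *: w i.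

Lemma hold_state_vertices i :
  hold_state A B i x u =
  (e / rho l) *: \sum_k a k *: hold_state A B i (rho l *: v k) (w k).
Proof.
rewrite -hold_state_comb /x; congr (hold_state _ _ _ _ _).
rewrite !scaler_sumr; apply: eq_bigr => k _; rewrite !scalerA.
by rewrite [e / rho l * _ * _]mulrAC divfK// lt0r_neq0.
Qed.

Lemma hold_state_scale_set :
  scale_set (e * eps) (convex_hull v) (hold_state A B j x u).
Proof.
have [_ _ _ /(_ _)/cid2-/all_sig2[s vs sE]] := feas.
exists (\sum_k a k *: s k); first exact: convex_hull_comb.
rewrite hold_state_vertices; under [in RHS]eq_bigr do rewrite -sE scalerA mulrC.
under [in RHS]eq_bigr do rewrite -scalerA.
rewrite -scaler_sumr scalerA; congr (_ *: _).
(* The factor [rho l] on the right of (C.2) cancels the division by [rho l] in the control law. *)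
by rewrite [eps * _]mulrC mulrA divfK// lt0r_neq0.
Qed.

Lemma norm_hold_state_le M i :
  (forall y, X y -> `|y| <= M) -> (forall k, X (rho l *: v k)) ->
  (i <= j)%N -> `|hold_state A B i x u| <= e / rho l * M.
Proof.
move=> XM Xv ij; have [_ _ C1 _] := feas.
have e_rho : 0 <= e / rho l by rewrite divr_ge0// ltW.
rewrite hold_state_vertices normrZ ger0_norm//.
apply/ler_wpM2l/norm_convex_comb => // k; apply: XM.
(* (C.1) starts at time [1]; at time [0] the state is the scaled vertex itself, in [X] by
   assumption. *)
have [->|i0] := posnP i; first by rewrite hold_state0.
by apply: C1; rewrite i0.
Qed.

End Period.

Theorem theorem2 (R : realType) (n m : nat)
    (A : 'M[R]_n) (B : 'M[R]_(n, m))
    (ctrlAB : controllable A B) (rankB : \rank B = m)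
    (px pu : nat) (Hx : 'M[R]_(px, n)) (hx : 'cV[R]_px)
    (Hu : 'M[R]_(pu, m)) (hu : 'cV[R]_pu)
    (hx_gt0 : forall i, 0 < hx i 0) (hu_gt0 : forall i, 0 < hu i 0)
    (X_C : C_set (polyhedron Hx hx)) (U_C : C_set (polyhedron Hu hu))
    (lam : R) (lam_ge0 : 0 <= lam) (lam_lt1 : lam < 1)
    (S : set 'cV[R]_n)
    (S_contr : contractive A B lam (polyhedron Hx hx) (polyhedron Hu hu) S)
    (N : nat) (v : 'I_N -> 'cV[R]_n) (S_vert : polytope_with_vertices S v)
    (jmax : nat) (jmax_ge1 : (1 <= jmax)%N)
    (w1 w2 : R) (w1_ge0 : 0 <= w1) (w2_ge0 : 0 <= w2)
    (L : nat) (L_ge1 : (1 <= L)%N)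
    (rho : nat -> R) (rhoP : scaling_factors L rho)
    (uopt : nat -> nat -> 'I_N -> 'cV[R]_m) (epsopt : nat -> nat -> R)
    (optP : forall l j, (1 <= l <= L)%N -> (1 <= j <= jmax)%N ->
      is_feasible A B (polyhedron Hx hx) (polyhedron Hu hu) S v rho lam l j ->
      optimal A B (polyhedron Hx hx) (polyhedron Hu hu) S v rho lam l j
        (uopt l j) (epsopt l j))
    (jstar : nat -> nat)
    (jstarP : forall l, (1 <= l <= L)%N ->
      is_argmax
        (feasible_horizons A B (polyhedron Hx hx) (polyhedron Hu hu) S v rho
           lam jmax l)
        (fun j => horizon_score w1 w2 (epsopt l j) j) (jstar l))
    (Gamma : 'cV[R]_n -> nat)
    (GammaP : forall l y, (1 <= l <= L)%N -> layer S rho l y ->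
      Gamma y = jstar l)
    (x : nat -> 'cV[R]_n) (u : nat -> 'cV[R]_m)
    (loopP : closed_loop A B S v L rho uopt Gamma x u)
    (x0S : S (x 0%N)) :
  x @ \oo --> (0 : 'cV[R]_n).
Proof.
have [_ S_X _] := S_contr; have [S_hull _ _] := S_vert.
have S0 : S 0 by have [[_ _ /nbhs_singleton]] := S_contr.
have [X_compact _ _] := X_C; have [rho1_gt0 _ _] := rhoP.
have [M XM] : exists M, forall y, polyhedron Hx hx y -> `|y| <= M.
  (* Boundedness provides every [M > M0] as a bound, whence [M0 + 1]. *)
  have [M0 [_ HM]] := compact_bounded X_compact.
  by exists (M0 + 1) => y Xy; apply: HM => //; rewrite ltrDl.
have M_ge0 : 0 <= M by rewrite (le_trans _ (XM _ (S_X _ S0))).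
have S_scale mu y : 0 <= mu <= 1 -> S y -> S (mu *: y).
  by rewrite S_hull in S0 *; exact: convex_hull_scale.
have [xP [k [ustar [k0 kS ustarP uE]]]] := loopP.
pose e q := gauge_fun S (x (k q)).
(* The control law is known only at samples lying in a layer, so membership in [S] has to be passed
   on from each sample to the next. *)
have period q : S (x (k q)) -> [/\ (k q < k q.+1)%N, S (x (k q.+1)),
    e q.+1 <= lam * e q &
    forall t, (k q <= t < k q.+1)%N -> `|x t| <= M / rho 1%N * e q].
  move=> Sx; have [l lL xl] := layer_cover _ _ _ _ L_ge1 rhoP Sx.
  have /andP[rho1l rhol1] := scaling_factors_bounds _ _ _ rhoP lL.
  have rhol_gt0 : 0 < rho l := lt_le_trans rho1_gt0 rho1l.
  (* As a feasible horizon, [jstar l] is at least [1], so time advances, and the inputs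
     [uopt l (jstar l)] satisfy the constraints with a factor at most [lam]. *)
  have GE := GammaP _ _ lL xl; have [[/= j_bounds j_feas] _] := jstarP _ lL.
  have j_ge1 : (1 <= jstar l)%N by case/andP: j_bounds.
  have [feas _] := optP _ _ lL j_bounds j_feas.
  have [_ /andP[eps_ge0 eps_le] _ _] := feas.
  have [a [aP xE usE]] := ustarP q l lL xl.
  rewrite -/(e q) in xE usE; rewrite GE in usE.
  have e_ge0 : 0 <= e q := gauge_fun_ge0 _ _.
  have e_le1 : e q <= 1 := gauge_fun_le1 _ _ Sx.
  have kSE : k q.+1 = (k q + jstar l)%N by rewrite kS GE.
  have hold i : (i <= jstar l)%N ->
      x (k q + i)%N = hold_state A B i (x (k q)) (ustar q).
    move=> ij; apply: trajectory_hold => // t /andP[qt ti].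
    by apply: uE; rewrite qt kSE (leq_trans ti)// leq_add2l.
  have e_eps : 0 <= e q * epsopt l (jstar l) by rewrite mulr_ge0.
  have next : scale_set (e q * epsopt l (jstar l)) S (x (k q.+1)).
    rewrite kSE hold// xE usE S_hull.
    by rewrite S_hull in feas; exact: hold_state_scale_set feas aP rhol_gt0.
  split.
  - by rewrite kSE -[X in (X < _)%N]addn0 ltn_add2l.
  (* The next sample is a point of [S] scaled by a factor in [[0, 1]], and [S] is convex and
     contains [0]. *)
  - case: (next) => s Ss <-; apply: S_scale => //; rewrite e_eps/=.
    by rewrite mulr_ile1// (le_trans eps_le)// ltW.
  - apply: le_trans (gauge_fun_le _ _ _ e_eps next) _.
    by rewrite mulrC ler_wpM2r.
  - move=> t /andP[qt]; rewrite kSE -(subnKC qt) ltn_add2l => /ltnW tj.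
    rewrite hold// xE usE.
    have Xv i : polyhedron Hx hx (rho l *: v i).
      apply/S_X/S_scale; first by rewrite ltW.
      by have [_ _ /(_ i)[]] := S_vert.
    rewrite S_hull in feas.
    apply: le_trans; first exact: norm_hold_state_le feas aP _ _ _ _ XM Xv tj.
    (* Since [rho 1 <= rho l], replacing [rho l] by [rho 1] makes the constant the same for all
       layers. *)
    by rewrite mulrC mulrCA mulrC ler_wpM2r// ler_wpM2l// lef_pV2.
have inv q : S (x (k q)) /\ e q <= lam ^+ q.
  elim: q => [|q [Sx eq]].
    by rewrite /e k0 expr0; split=> //; exact: gauge_fun_le1.
  have [_ Sx' e' _] := period q Sx; split=> //.
  by rewrite (le_trans e')// exprS ler_wpM2l.
have kmono q : (k q < k q.+1)%N by have [] := period q (inv q).1.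
apply/cvgr0Pnorm_lt => eps eps_gt0.
(* This sequence bounds the norm of the state throughout the [q]-th period; every time from [k Q] on
   lies in a period of index at least [Q]. *)
have geo : M / rho 1%N * lam ^+ q @[q --> \oo] --> 0.
  rewrite -(mulr0 (M / rho 1%N)); apply: cvgMr.
  by apply: cvg_expr; rewrite ger0_norm.
have [Q _ QP] := cvgr0_norm_lt _ geo _ eps_gt0.
exists (k Q) => // t /= /(nat_interval_cover _ _ _ kmono)[q Qq qt].
have [_ _ _ /(_ t qt) xt] := period q (inv q).1.
apply: le_lt_trans xt (le_lt_trans _ (QP q Qq)).
rewrite ler_normr ler_wpM2l ?(inv q).2//.
by rewrite divr_ge0// ltW.
Qed.
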